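(* Let $I$ be a finite set of students, $C$ a finite set of schools, and $(q_c)_{c\in C}$ capacities with $q_c\in\mathbb{N}$. Let $\varphi=(\sigma,\psi)$ be a mechanism in the setting with weak original priorities and a refinement (tie-breaking) rule. If $\varphi$ satisfies strategy-proofness, weak rank monotonicity, and strong RD stability, then $\varphi$ is outcome equivalent to the student-proposing Deferred Acceptance mechanism with tie-breaking rule $\tau$; that is, $\varphi(P,\succsim,\tau)=DA^S(P,\succ^{\tau})$ for every preference profile $P$, every profile of weak original priorities $\succsim$, and every refinement rule $\tau$, where $\succ^\tau$ is the strict priority profile obtained by refining $\succsim$ with $\tau$.
   Context: Preferences. $\mathcal{P}$ is the set of strict preference relations (strict linear orders) over $C\cup\{\emptyset\}$, where $\emptyset$ denotes being unmatched. For $P_i\in\mathcal{P}$, $x\,R_i\,y$ means $x\,P_i\,y$ or $x=y$. A preference profile is $P=(P_i)_{i\in I}$, and $(P_i',P_{-i})$ is the profile in which $i$'s preference is replaced by $P'_i$. $r_{ic}(P_i)\in\mathbb{N}$ is the rank (position) of $c$ in $P_i$, the most preferred element having rank $1$. Weak priorities and refinements. A weak priority profile is $\succsim=(\succsim_c)_{c\in C}$, each $\succsim_c$ a weak order (complete, transitive) over $I$, with strict part $\succ_c$ and tie relation $\sim_c$. A refinement (tie-breaking) rule is $\tau=(\tau_c)_{c\in C}$, each $\tau_c$ a strict linear order over $I$. The $\tau$-refinement of a weak priority profile $\succsim$ is the strict priority profile $\succ^\tau$ where $i\succ^\tau_c j$ if and only if $i\succ_c j$, or $i\sim_c j$ and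 $i\,\tau_c\,j$. Matchings. $\mathcal{M}$ is the set of maps $\mu:I\to C\cup\{\emptyset\}$ such that $\mu(c):=\{i\in I:\mu(i)=c\}$ satisfies $|\mu(c)|\le q_c$ for every $c\in C$. Mechanisms. A mechanism $\varphi=(\sigma,\psi)$ consists of a modification rule $\sigma$, which maps $(P,\succsim)$ to a (possibly weak) modified priority profile $\succsim^*=\sigma(P,\succsim)$, and a matching rule $\psi$, which maps a preference profile and a strict priority profile to a matching in $\mathcal{M}$. The outcome is $\varphi(P,\succsim,\tau)=\psi(P,\succ^{*,\tau})$, where $\succ^{*,\tau}$ is the $\tau$-refinement of $\succsim^*$. $\varphi_i(P,\succsim,\tau)$ denotes student $i$'s assignment. Stability. A matching $\mu$ is stable with respect to $(P,\succ)$, where $\succ$ is a strict priority profile, if: for every $i\in I$, $\mu(i)\,P_i\,\emptyset$ or $\mu(i)=\emptyset$; for every $i\in I$ and $c\in C$, $c\,P_i\,\mu(i)$ implies $|\mu(c)|=q_c$; and there is no $(i,c)\in I\times C$ such that $c\,P_i\,\mu(i)$ and $i\succ_c j$ for some $j\in\mu(c)$. Axioms. - Strategy-proofness: for all $i\in I$, $\succsim$, $\tau$, $P$, and $P_i'\in\mathcal{P}$: $\varphi_i(P,\succsim,\tau)\,R_i\,\varphi_i((P_i',P_{-i}),\succsim,\tau)$. - Weak rank monotonicity: for all $P$, $\succsim$, $\tau$, $c\in C$, $i,j\in I$, with $\succsim^*=\sigma(P,\succsim)$: (i) if $i\succ_c j$ and $r_{ic}(P_i)\le r_{jc}(P_j)$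 then $i\succ^*_c j$; (ii) if $i\succsim_c j$ and $r_{ic}(P_i)\le r_{jc}(P_j)$ then $i\succsim^*_c j$. - Strong RD stability: for all $P$, $\succsim$, $\tau$, the outcome $\varphi(P,\succsim,\tau)$ is stable with respect to $(P,\succ^{*,\tau})$. Student-proposing DA. $DA^S(P,\succ)$ is the outcome of the standard Gale–Shapley student-proposing deferred acceptance algorithm under preferences $P$, strict priorities $\succ$, and capacities $(q_c)$ (students propose only to schools preferred to $\emptyset$; schools find all students acceptable); equivalently, it is the student-optimal matching among those stable with respect to $(P,\succ)$. *)

(* Defs.v *)
From HB Require Import structures.
From mathcomp Require Import all_boot.

Set Implicit Arguments.
Unset Strict Implicit.
Unset Printing Implicit Defensive.

Record strict_order (T : Type) := StrictOrder {
  strict_rel :> rel T;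
  strict_irr : irreflexive strict_rel;
  strict_trans : transitive strict_rel;
  strict_total : forall x y, x <> y -> strict_rel x y || strict_rel y x }.

Record weak_order (T : Type) := WeakOrder {
  weak_rel :> rel T;
  weak_total : total weak_rel;
  weak_trans : transitive weak_rel }.

Section Refinement.
Variables (T : Type) (w : weak_order T) (t : strict_order T).

Definition above (x y : T) : bool := w x y && ~~ w y x.
Definition tied (x y : T) : bool := w x y && w y x.

Definition refine_rel (x y : T) : bool := above x y || (tied x y && t x y).

Lemma refine_irr : irreflexive refine_rel.
Proof. by move=> x; rewrite /refine_rel /above strict_irr andbF andbN. Qed.

Lemma refine_trans : transitive refine_rel.
Proof.
move=> y x z; rewrite /refine_rel /above /tied.
have T1 := @weak_trans _ w y x z; have T2 := @weak_trans _ w x z y.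
have T3 := @weak_trans _ w z y x; have T4 := @weak_trans _ w y z x.
have S := @strict_trans _ t y x z.
case: (w x y) (w y x) (w y z) (w z y) (w x z) (w z x) (t x y) (t y z) (t x z)
  T1 T2 T3 T4 S => [] [] [] [] [] [] [] [] [] //= T1 T2 T3 T4 S;
  by [| apply: T1 | apply: T2 | apply: T3 | apply: T4 | apply: S].
Qed.

Lemma refine_total x y : x <> y -> refine_rel x y || refine_rel y x.
Proof.
move=> /(@strict_total _ t); rewrite /refine_rel /above /tied.
have := weak_total w x y.
by case: (w x y); case: (w y x); case: (t x y); case: (t y x).
Qed.

Definition refine : strict_order T :=
  StrictOrder refine_irr refine_trans refine_total.

End Refinement.

(* The unmatched option is [None : option C]. *)
Definition preference (C : Type) := strict_order (option C).
Definition pref_profile (I C : Type) := I -> preference C.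
Definition weak_profile (I C : Type) := C -> weak_order I.
Definition strict_profile (I C : Type) := C -> strict_order I.

Definition refine_profile (I C : Type) (w : weak_profile I C)
    (tau : strict_profile I C) : strict_profile I C :=
  fun c => refine (w c) (tau c).

Definition weakly_prefers (C : Type) (p : preference C) (x y : option C) : Prop :=
  p x y \/ x = y.

(* Position of [c] among all of [option C], the unmatched option included;
   the most preferred element has rank 1. *)
Definition rank (C : finType) (p : preference C) (c : C) : nat :=
  #|[set x | p x (Some c)]|.+1.

Section Market.
Variables (I C : finType) (q : C -> nat).

Definition assigned (mu : {ffun I -> option C}) (c : C) : {set I} :=
  [set i | mu i == Some c].

Record matching := Matching {
  assignment :> {ffun I -> option C};
  _ : [forall c, #|assigned assignment c| <= q c] }.

HB.instance Definition _ := [isSub for assignment].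
HB.instance Definition _ := [Finite of matching by <:].

Record mechanism := Mechanism {
  modification : pref_profile I C -> weak_profile I C -> weak_profile I C;
  matching_rule : pref_profile I C -> strict_profile I C -> matching }.

Definition outcome (phi : mechanism) (P : pref_profile I C)
    (w : weak_profile I C) (tau : strict_profile I C) : matching :=
  matching_rule phi P (refine_profile (modification phi P w) tau).

Definition individually_rational (P : pref_profile I C) (mu : matching) : Prop :=
  forall i, P i (mu i) None \/ mu i = None.

Definition non_wasteful (P : pref_profile I C) (mu : matching) : Prop :=
  forall i c, P i (Some c) (mu i) -> #|assigned mu c| = q c.

Definition has_justified_envy (P : pref_profile I C) (s : strict_profile I C)
    (mu : matching) (i : I) (c : C) : Prop :=
  P i (Some c) (mu i) /\ exists2 j, j \in assigned mu c & s c i j.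

Definition stable (P : pref_profile I C) (s : strict_profile I C)
    (mu : matching) : Prop :=
  [/\ individually_rational P mu, non_wasteful P mu
    & ~ exists i c, has_justified_envy P s mu i c].

Definition deviate (P : pref_profile I C) (i : I) (p' : preference C) :
    pref_profile I C :=
  fun j => if j == i then p' else P j.

Definition strategy_proof (phi : mechanism) : Prop :=
  forall i w tau (P : pref_profile I C) (p' : preference C),
    weakly_prefers (P i) (outcome phi P w tau i)
      (outcome phi (deviate P i p') w tau i).

Definition weak_rank_monotone (phi : mechanism) : Prop :=
  forall P w c i j,
    rank (P i) c <= rank (P j) c ->
    (above (w c) i j -> above (modification phi P w c) i j) /\
    (w c i j -> modification phi P w c i j).

Definition strong_RD_stable (phi : mechanism) : Prop :=
  forall P w tau,
    stable P (refine_profile (modification phi P w) tau) (outcome phi P w tau).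

Section DeferredAcceptance.
Variables (P : pref_profile I C) (s : strict_profile I C).

(* [(i, c) \in R] means that [c] has already rejected [i]. *)
Implicit Type R : {set I * C}.

Definition available R (i : I) (x : option C) : bool :=
  if x is Some c then (i, c) \notin R else true.

(* The most preferred option that has not rejected [i].  Being unmatched is
   always available, so [i] only ever proposes to schools preferred to it, and
   a student held by a school keeps proposing to that school. *)
Definition proposal R (i : I) : option C :=
  odflt None [pick x | available R i x &
    [forall y, available R i y ==> (y == x) || P i x y]].

Definition accepted R (i : I) (c : C) : bool :=
  (proposal R i == Some c) &&
  (#|[set j | (proposal R j == Some c) && s c j i]| < q c).

Definition rejected R (i : I) (c : C) : bool :=
  (proposal R i == Some c) && ~~ accepted R i c.

Definition DA_round R : {set I * C} := R :|: [set x | rejected R x.1 x.2].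

(* Every round before termination adds a rejection, so [#|I * C|] rounds are
   enough: see [DA_rejections_final]. *)
Definition DA_rejections : {set I * C} := iter #|{: I * C}| DA_round set0.

Definition held R : {ffun I -> option C} :=
  [ffun i => if proposal R i is Some c
             then if accepted R i c then Some c else None
             else None].

Lemma DA_rejections_final : DA_round DA_rejections = DA_rejections.
Proof.
rewrite /DA_rejections; set n := #|_|.
have step k : DA_round (iter k DA_round set0) = iter k DA_round set0 \/
              k < #|DA_round (iter k DA_round set0)|.
  elim: k => [|k [E|IH]].
  - have [->|N0] := eqVneq (DA_round (iter 0 DA_round set0)) set0; first by left.
    by right; rewrite card_gt0.
  - by left; rewrite iterS E.
  - rewrite iterS; set R := DA_round _ in IH *.
    have sub : R \subset DA_round R by apply: subsetUl.
    have [E|N] := eqVneq (DA_round R) R; [by left | right].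
    apply: leq_ltn_trans IH _; apply: proper_card.
    by rewrite properEneq eq_sym N.
by case: (step n) => // /leq_trans/(_ (max_card _)); rewrite ltnn.
Qed.

Lemma held_assigned R c : assigned (held R) c = [set i | accepted R i c].
Proof.
apply/setP=> i; rewrite !inE ffunE.
have acc d : accepted R i d -> proposal R i = Some d by case/andP=> /eqP.
case E: (proposal R i) => [d|].
  case: ifP => A.
    by apply/eqP/idP => [[<-]|/acc] //; rewrite E.
  by apply/esym/negP => A'; move: (acc _ A') A; rewrite E => -[->]; rewrite A'.
by apply/esym/negP => /acc; rewrite E.
Qed.

Lemma held_capacity R : [forall c, #|assigned (held R) c| <= q c].
Proof.
apply/forallP => c; rewrite held_assigned; set A := [set i | _].
have [->|[i0 Ai0]] := set_0Vmem A; first by rewrite cards0.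
pose f i := #|[set j in A | s c j i]|.
pose i := [arg max_(i > i0 in A) f i].
have [Ai imax] : i \in A /\ forall j, j \in A -> f j <= f i.
  by rewrite /i; case: arg_maxnP.
have low j : j \in A -> j != i -> s c j i.
  move=> Aj /eqP/(@strict_total _ (s c)) /orP[//|sij].
  have: f i < f j.
    apply: proper_card; apply/properP; split.
      apply/subsetP => k; rewrite !inE => /andP[-> ski] /=.
      exact: strict_trans ski sij.
    by exists i; rewrite !inE ?sij ?strict_irr ?andbF // andbT; rewrite inE in Ai.
  by rewrite ltnNge imax.
rewrite (cardsD1 i) Ai add1n.
have := Ai; rewrite inE => /andP[_ ]; apply: leq_trans; rewrite ltnS.
apply: subset_leq_card; apply/subsetP => j.
rewrite in_setD1 => /andP[ji Aj]; rewrite inE low // andbT.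
by move: Aj; rewrite inE => /andP[].
Qed.

Definition DA : matching := Matching (held_capacity DA_rejections).

End DeferredAcceptance.
End Market.

(* Main.v *)
(** Fix the priorities and the tie-breaking, and let [F] be the induced rule on
    preference profiles.

    First, [F] weakly dominates DA.  Take a profile with the fewest acceptable
    schools at which some student gets a worse school under [F] than under DA.
    If student [i] is worse off, then by strategy-proofness [i] remains so when
    reporting only the DA school [c] as acceptable; hence by minimality [c] is
    the only acceptable school of [i] and has rank 1.  Weak rank monotonicity
    then lets [i] keep the original priority over everyone else, so [F] fills [c] with
    students of higher refined priority than [i].  One of them, [j], is not at
    [c] under DA, hence prefers the DA school to [c]: [j] is worse off too but
    has two acceptable schools, a contradiction.

    Second, a rule dominating a non-wasteful and individually rational one
    matches the same students.  If [i] strictly preferred [c = F_i] to the DA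
    school, truncate the list of [i] below [c]: by strategy-proofness [i] is
    still matched under [F], hence under DA, to a school at least as good as
    [c].  That DA matching is stable for the true preferences, contradicting
    the optimality of DA among stable matchings. *)
Require Import Defs.
From Stdlib Require Import FunctionalExtensionality.
From HB Require Import structures.
From mathcomp Require Import all_boot.

Set Implicit Arguments.
Unset Strict Implicit.
Unset Printing Implicit Defensive.

(** * Strict linear orders on finite types *)

Lemma strict_asym (T : Type) (s : strict_order T) x y : s x y -> s y x -> False.
Proof. by move=> xy yx; have := strict_trans xy yx; rewrite strict_irr. Qed.

Lemma strict_max (T : finType) (s : strict_order T) (A : {set T}) :
  A != set0 -> exists2 x, x \in A & forall y, y \in A -> y != x -> s x y.
Proof.
case/set0Pn=> x0 Ax0; pose f x := #|[set y in A | s x y]|.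
case: (arg_maxnP f Ax0) => x Ax max_x.
exists x => // y Ay /eqP/(@strict_total _ s)/orP[syx|//].
have: f x < f y.
  apply: proper_card; apply/properP; split.
    apply/subsetP=> z; rewrite !inE => /andP[-> sxz] /=.
    exact: strict_trans syx sxz.
  by exists x; rewrite !inE ?syx ?strict_irr ?andbF ?andbT.
by rewrite ltnNge; have /= -> := max_x y Ay.
Qed.

(** Otherwise the best element of [A] outside this top set would have only members of the set above
    it, hence fewer than [n], and would belong to it. *)
Lemma card_top (T : finType) (s : strict_order T) (A : {set T}) n :
  n <= #|A| -> n <= #|[set x in A | #|[set y in A | s y x]| < n]|.
Proof.
move=> leA; set B := [set x in A | _]; rewrite leqNgt; apply/negP=> ltB.
have AB0 : A :\: B != set0.
  rewrite setD_eq0; apply/negP=> /subset_leq_card leAB.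
  by rewrite ltnNge (leq_trans leA leAB) in ltB.
have [x] := strict_max s AB0; rewrite inE => /andP[BNx Ax] max_x.
case/negP: BNx; rewrite inE Ax /=; apply: leq_ltn_trans ltB.
apply: subset_leq_card; apply/subsetP=> y; rewrite inE => /andP[Ay syx].
apply/idPn=> BNy; have yx : y != x by apply/eqP=> E; rewrite E strict_irr in syx.
have ABy : y \in A :\: B by rewrite inE BNy.
exact: strict_asym syx (max_x _ ABy yx).
Qed.

(** * Truncated preference lists *)

Section RestrictedPreference.
Variables (C : finType) (A : pred (option C)) (p : preference C).

Definition restrict_key (x : option C) : nat :=
  if A x then 0 else if x == None then 1 else 2.

(** A weak order with three indifference classes, so that breaking its ties by [p] yields a strict
    order at once. *)
Definition restrict_weak : weak_order (option C) :=
  @WeakOrder _ (fun x y => restrict_key x <= restrict_key y)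
    (fun x y => leq_total _ _) (fun y x z => @leq_trans _ _ _).

(* [A] first, then being unmatched, then the other schools, ordered by [p]
   within each class. *)
Definition restrict : preference C := refine restrict_weak p.

Lemma restrictE x y :
  restrict x y = (restrict_key x < restrict_key y) ||
                 (restrict_key x == restrict_key y) && p x y.
Proof.
rewrite /restrict /= /refine_rel /above /tied /= -ltnNge -eqn_leq.
by case: (ltnP (restrict_key x)) => [/ltnW->|] //=; rewrite andbF.
Qed.

Lemma restrict_in x y : A y -> restrict x y -> A x /\ p x y.
Proof.
rewrite restrictE /restrict_key => ->.
by case: (A x) => //=; case: (x == None).
Qed.

Lemma restrict_agree x y : A x -> A y -> restrict x y = p x y.
Proof. by rewrite restrictE /restrict_key => -> ->. Qed.

Lemma restrict_None x : ~~ A None -> restrict x None = A x.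
Proof.
rewrite restrictE /restrict_key => /negPf->.
by case Ax: (A x) => //=; case: eqP => //= ->; rewrite strict_irr.
Qed.

End RestrictedPreference.

(** * Unilateral deviations and weak preference *)

Lemma deviate_same (I C : finType) (P : pref_profile I C) i p :
  deviate P i p i = p.
Proof. by rewrite /deviate eqxx. Qed.

Lemma deviate_other (I C : finType) (P : pref_profile I C) i p j :
  j != i -> deviate P i p j = P j.
Proof. by rewrite /deviate => /negPf->. Qed.

Lemma prefers_trans (C : Type) (p : preference C) x y z :
  weakly_prefers p x y -> weakly_prefers p y z -> weakly_prefers p x z.
Proof.
by case=> [xy|-> //] [yz|<-]; left=> //; apply: strict_trans yz.
Qed.

Lemma not_prefers (C : eqType) (p : preference C) (x y : option C) :
  ~ p y x -> weakly_prefers p x y.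
Proof.
move=> nyx; have [->|/eqP xy] := eqVneq x y; first by right.
by have /orP[|//] := strict_total p xy; left.
Qed.

Lemma prefers_not (C : eqType) (p : preference C) (x y : option C) :
  weakly_prefers p x y -> ~ p y x.
Proof. by case=> [xy|->]; [apply: strict_asym | rewrite strict_irr]. Qed.

Lemma deviate_back (I C : finType) (P : pref_profile I C) i p :
  deviate (deviate P i p) i (P i) = P.
Proof. by apply: functional_extensionality => j; rewrite /deviate; case: eqP => [->|]. Qed.

(** * Counting matched students and transferring stability *)

Section Matchings.
Variables (I C : finType) (q : C -> nat).
Implicit Types (P : pref_profile I C) (s : strict_profile I C).
Implicit Types mu nu : matching I q.

Lemma matching_capacity mu c : #|assigned mu c| <= q c.
Proof. by case: mu => m /= /forallP. Qed.

Lemma card_matched mu :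
  #|[set i | mu i != None]| = \sum_c #|assigned mu c|.
Proof.
under eq_bigr do rewrite -sum1dep_card big_mkcond /=.
rewrite exchange_big /= -sum1dep_card big_mkcond /=; apply: eq_bigr => i _.
case: (mu i) => [c|] /=; last by rewrite big1.
rewrite (bigD1 c) //= eqxx big1 // => d /negPf dc.
by rewrite (inj_eq Some_inj) eq_sym dc.
Qed.

(** A school with a newcomer under [nu] is already full under [mu], so no school gains students; by
    domination, nobody matched under [mu] loses a place. The counts then force equality. *)
Lemma dominating_matched P mu nu :
  individually_rational P mu -> non_wasteful P mu ->
  (forall i, weakly_prefers (P i) (nu i) (mu i)) ->
  forall i, nu i != None -> mu i != None.
Proof.
move=> IR NW dom i nui.
have sub : [set j | mu j != None] \subset [set j | nu j != None].
  apply/subsetP=> j; rewrite !inE; apply: contra_neq => nuj.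
  have := dom j; rewrite nuj => /prefers_not np.
  by case: (IR j).
have le c : #|assigned nu c| <= #|assigned mu c|.
  have [/subset_leq_card //|/subsetPn[j]] := boolP (assigned nu c \subset assigned mu c).
  rewrite !inE => /eqP nuj /eqP muj.
  have := dom j; rewrite nuj => -[/NW ->|/esym //].
  exact: matching_capacity.
have E : [set j | mu j != None] = [set j | nu j != None].
  by apply/eqP; rewrite eqEcard sub !card_matched leq_sum.
by move: nui; have /setP/(_ i) := E; rewrite !inE => ->.
Qed.

Lemma stable_transfer P P' s mu :
  (forall i x, P' i x (mu i) -> P i x (mu i)) ->
  individually_rational P' mu -> stable P s mu -> stable P' s mu.
Proof.
move=> sub IR [_ NW NE]; split=> // [i c /sub/NW //|[i [c [/sub Pic envy]]]].
by case: NE; exists i, c.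
Qed.

End Matchings.

(** * Stability and optimality of deferred acceptance *)

Section DeferredAcceptanceTheory.
Variables (I C : finType) (q : C -> nat).
Variables (P : pref_profile I C) (s : strict_profile I C).
Implicit Types (R : {set I * C}) (mu : matching I q).

Lemma proposalP R i :
  available R i (proposal P R i) /\
  forall x, available R i x -> weakly_prefers (P i) (proposal P R i) x.
Proof.
rewrite /proposal; case: pickP => [x /andP[Rx /forallP max_x]|none] /=.
  split=> // y Ry; move: (max_x y); rewrite Ry /= => /orP[/eqP->|]; first by right.
  by left.
have N0 : [set x | available R i x] != set0 by apply/set0Pn; exists None; rewrite inE.
have [x] := strict_max (P i) N0; rewrite inE => Rx max_x.
case/negP: (negbT (none x)); rewrite Rx; apply/forallP=> y; apply/implyP=> Ry.
by have [//|yx] := eqVneq y x; rewrite max_x ?inE.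
Qed.

Lemma proposal_grow R R' i :
  R \subset R' -> available R' i (proposal P R i) ->
  proposal P R' i = proposal P R i.
Proof.
move=> sub avail; have [Ra Rmax] := proposalP R i; have [Ra' Rmax'] := proposalP R' i.
have np := prefers_not (Rmax' _ avail).
case: (Rmax (proposal P R' i)) => //.
by case: (proposal P R' i) Ra' => //= c; apply/contra/subsetP.
Qed.

Lemma DA_rejections_ind (Q : {set I * C} -> Prop) :
  Q set0 -> (forall R, Q R -> Q (DA_round q P s R)) -> Q (DA_rejections q P s).
Proof. by move=> Q0 QS; rewrite /DA_rejections; elim: #|_| => //= n; apply: QS. Qed.

Definition better_proposers R i c : {set I} :=
  [set j | (proposal P R j == Some c) && s c j i].

Lemma rejectedE R i c :
  rejected q P s R i c =
  (proposal P R i == Some c) && (q c <= #|better_proposers R i c|).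
Proof. by rewrite /rejected /accepted; case: eqP => //=; rewrite -leqNgt. Qed.

(** The [q c] best of these proposers survive the round and propose to [c] again. *)
Lemma better_proposers_round R i c :
  q c <= #|better_proposers R i c| ->
  q c <= #|better_proposers (DA_round q P s R) i c|.
Proof.
move=> /(card_top (s c))/leq_trans; apply.
apply: subset_leq_card; apply/subsetP=> j; rewrite !inE.
case/andP=> /andP[/eqP Pj sji] lt; rewrite sji andbT.
rewrite (@proposal_grow R) ?Pj ?subsetUl //= inE negb_or.
have [+ _] := proposalP R j; rewrite Pj /= => -> /=.
rewrite inE /= rejectedE Pj eqxx /= -ltnNge; apply: leq_ltn_trans lt.
apply: subset_leq_card; apply/subsetP=> k; rewrite !inE => /andP[-> skj].
by rewrite skj (strict_trans skj sji).
Qed.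

Lemma DA_rejections_full i c :
  (i, c) \in DA_rejections q P s ->
  q c <= #|better_proposers (DA_rejections q P s) i c|.
Proof.
move: i c; pattern (DA_rejections q P s); apply: DA_rejections_ind => [i c|R IH i c]; first by rewrite inE.
rewrite inE => /orP[/IH|]; first exact: better_proposers_round.
by rewrite inE rejectedE => /andP[_]; apply: better_proposers_round.
Qed.

Lemma DA_proposal i : DA q P s i = proposal P (DA_rejections q P s) i.
Proof.
rewrite /DA /= ffunE; set R := DA_rejections q P s.
case E: (proposal P R i) => [c|] //; case: ifPn => // nacc.
have: (i, c) \in R by rewrite /R -DA_rejections_final !inE /rejected -/R E eqxx nacc orbT.
by have [+ _] := proposalP R i; rewrite E /= => /negPf->.
Qed.

Lemma DA_best i x :
  available (DA_rejections q P s) i x -> weakly_prefers (P i) (DA q P s i) x.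
Proof. by rewrite DA_proposal; case: (proposalP (DA_rejections q P s) i) => _; apply. Qed.

(** Here [c] has rejected [i], so at least [q c] better students propose to it at the end; capacity
    leaves room for nobody else. *)
Lemma DA_desired i c :
  P i (Some c) (DA q P s i) ->
  #|assigned (DA q P s) c| = q c /\ forall j, j \in assigned (DA q P s) c -> s c j i.
Proof.
move=> Pic; set R := DA_rejections q P s.
have iR : (i, c) \in R.
  by apply/idPn=> /(@DA_best i (Some c))/prefers_not.
have sub : better_proposers R i c \subset assigned (DA q P s) c.
  by apply/subsetP=> j; rewrite !inE DA_proposal => /andP[].
have full := DA_rejections_full iR; have cap := matching_capacity (DA q P s) c.
have E : better_proposers R i c = assigned (DA q P s) c.
  by apply/eqP; rewrite eqEcard sub (leq_trans cap full).
split; first by apply/eqP; rewrite eqn_leq cap -E.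
by move=> j; rewrite -E inE => /andP[].
Qed.

Lemma DA_stable : stable P s (DA q P s).
Proof.
split=> [i|i c /DA_desired[] //|[i [c [/DA_desired[_ above] [j /above sji]]]]].
  exact: (@DA_best i None).
exact: strict_asym sji.
Qed.

(** Invariant of the rounds: no student is ever rejected by its school under [mu]. *)
Lemma DA_optimal mu :
  stable P s mu -> forall i, weakly_prefers (P i) (DA q P s i) (mu i).
Proof.
case=> _ _ NE i; apply: DA_best.
suff: forall j c, (j, c) \in DA_rejections q P s -> mu j != Some c.
  by move=> inv; case E: (mu i) => [c|] //=; apply/negP=> /inv; rewrite E eqxx.
pattern (DA_rejections q P s); apply: DA_rejections_ind => [j c|R IH j c]; first by rewrite inE.
rewrite inE => /orP[/IH //|]; rewrite inE rejectedE /= => /andP[_ full].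
apply/eqP=> muj.
(* Together with [j], the better proposers exceed the capacity of [c]. One left out by [mu] has not
   been rejected by its own [mu] school, so it prefers [c] and has justified envy. *)
have [k] : exists2 k, k \in better_proposers R j c & k \notin assigned mu c.
  apply/subsetPn/negP=> sub.
  have jN : j \notin better_proposers R j c by rewrite inE strict_irr andbF.
  have: j |: better_proposers R j c \subset assigned mu c by rewrite subUset sub1set inE muj eqxx.
  move/subset_leq_card; rewrite cardsU1 jN add1n => /leq_trans/(_ (matching_capacity mu c)).
  by rewrite ltnNge full.
rewrite !inE => /andP[/eqP Pk skj] muk; apply: NE; exists k, c; split; last first.
  by exists j; rewrite ?inE ?muj.
have avail : available R k (mu k).
  by case E: (mu k) => [d|] //=; apply/negP=> /IH; rewrite E eqxx.
have [_ /(_ _ avail)] := proposalP R k; rewrite Pk => -[] // E.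
by rewrite -E eqxx in muk.
Qed.

End DeferredAcceptanceTheory.

(** * Comparison of the mechanism with deferred acceptance *)

Section Mechanism.
Variables (I C : finType) (q : C -> nat) (phi : mechanism I q).
Hypothesis SP : strategy_proof phi.
Hypothesis WRM : weak_rank_monotone phi.
Hypothesis RDS : strong_RD_stable phi.
Variables (w : weak_profile I C) (tau : strict_profile I C).

Let s := refine_profile w tau.
Let F P := outcome phi P w tau.
Let D P := DA q P s.

(** An original tie either stays a tie, again broken by [tau], or becomes a strict advantage of
    [i]. *)
Lemma refine_rank_monotone (P : pref_profile I C) c i j :
  rank (P i) c <= rank (P j) c -> s c i j ->
  refine_profile (modification phi P w) tau c i j.
Proof.
move=> /(WRM w) [mono_above mono_weak].
rewrite /s /refine_profile /= /refine_rel => /orP[/mono_above->//|].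
case/andP=> /andP[/mono_weak wij _] tij; rewrite /above /tied wij tij /= andbT.
by case: (modification _ _ _ _ j i).
Qed.

Definition acceptable (p : preference C) : {set C} := [set c | p (Some c) None].

Lemma acceptable_single (c : C) (p : preference C) :
  acceptable (restrict (pred1 (Some c)) p) = [set c].
Proof. by apply/setP=> d; rewrite !inE restrict_None //= (inj_eq Some_inj). Qed.

(** The old DA matching stays stable, so optimality keeps [i] at [c]. Getting [c] from [F] would be
    a profitable lie at [P]. *)
Lemma single_worse (P : pref_profile I C) i c (p' := restrict (pred1 (Some c)) (P i)) :
  D P i = Some c -> P i (Some c) (F P i) ->
  D (deviate P i p') i = Some c /\ F (deviate P i p') i = None.
Proof.
move=> Di worse; set P' := deviate P i p'.
have p'N : p' (Some c) None by rewrite /p' restrict_None //= eqxx.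
have top x : ~ p' x (Some c).
  by case/(@restrict_in _ (pred1 (Some c)) (P i) x _ (eqxx _))=> /eqP->; rewrite strict_irr.
have st : stable P' s (D P).
  have [IR _ _] := DA_stable q P s.
  apply: stable_transfer (DA_stable q P s) => [j x|j].
    have [->|ji] := eqVneq j i; last by rewrite /P' deviate_other.
    by rewrite /P' deviate_same -/(D P) Di => /top.
  have [->|ji] := eqVneq j i; last by rewrite /P' deviate_other.
  by rewrite /P' deviate_same Di; left.
split.
  by case: (DA_optimal st i) => [|->] //; rewrite Di {1}/P' deviate_same => /top.
have [/(_ i) IR _ _] := RDS P' w tau.
case: IR => // IR; move: (SP i w tau P p'); rewrite -/P' -/(F P) -/(F P').
move: IR; rewrite {1}/P' deviate_same restrict_None //= => /eqP ->.
by move/prefers_not/(_ worse).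
Qed.

Lemma not_worse (P : pref_profile I C) i : ~ P i (D P i) (F P i).
Proof.
have [n] := ubnP (\sum_j #|acceptable (P j)|).
elim: n P i => // n IH P i0 size_P worse0.
have IRF k : P k (F P k) None \/ F P k = None by have [/(_ k)] := RDS P w tau.
have school k : P k (D P k) (F P k) ->
    exists2 c, D P k = Some c & P k (Some c) None.
  move=> worse; have DN : P k (D P k) None.
    by case: (IRF k) => [|<-] //; apply: strict_trans.
  by case E: (D P k) DN => [c|]; [exists c | rewrite strict_irr].
have small k : P k (D P k) (F P k) -> #|acceptable (P k)| <= 1.
  move=> worse; rewrite leqNgt; apply/negP=> big.
  have [c Dk cN] := school k worse; rewrite Dk in worse.
  have [Dk' Fk'] := single_worse Dk worse.
  apply: (IH (deviate P k (restrict (pred1 (Some c)) (P k))) k); last first.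
    by rewrite Dk' Fk' deviate_same restrict_None //= eqxx.
  rewrite -ltnS; apply: leq_trans size_P.
  rewrite ltnS (bigD1 k) //= [ltnRHS](bigD1 k) //= deviate_same acceptable_single cards1.
  rewrite -addSn leq_add //; apply: eq_leq; apply: eq_bigr => j jk.
  by rewrite deviate_other.
have [c Di cN] := school i0 worse0.
have [_ NW NE] := RDS P w tau; have worse : P i0 (Some c) (F P i0) by rewrite -Di.
have full := NW _ _ worse.
have top : rank (P i0) c = 1.
  congr _.+1; apply/eqP; rewrite cards_eq0; apply/eqP/setP=> x; rewrite !inE.
  apply/negP=> xc; have xN := strict_trans xc cN.
  case: x xc xN => [d|]; last by rewrite strict_irr.
  move=> dc dN; have /card_le1_eqP/(_ c d) := small _ worse0.
  by rewrite !inE => /(_ cN dN) E; rewrite E strict_irr in dc.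
have higher j : j \in assigned (F P) c -> s c j i0.
  move=> Fj; have ij : i0 <> j.
    by move=> E; move: Fj worse; rewrite -E inE => /eqP->; rewrite strict_irr.
  have /orP[sij|//] := @strict_total _ (s c) _ _ ij.
  case: NE; exists i0, c; split=> //; exists j => //.
  by apply: refine_rank_monotone sij; rewrite top.
(* [F] fills [c], so containment would be equality and put [i0] there too, above itself. *)
have [j Fj Dj] : exists2 j, j \in assigned (F P) c & j \notin assigned (D P) c.
  apply/subsetPn/negP=> sub.
  have E : assigned (F P) c = assigned (D P) c.
    by apply/eqP; rewrite eqEcard sub full matching_capacity.
  have: i0 \in assigned (F P) c by rewrite E inE Di.
  by move/higher; rewrite strict_irr.
have FjE : F P j = Some c by move: Fj; rewrite inE => /eqP.
(* Otherwise [j] would have justified envy of [i0] in the DA matching. *)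
have worse_j : P j (D P j) (F P j).
  rewrite FjE; apply/idPn=> nw; have : weakly_prefers (P j) (Some c) (D P j).
    exact/not_prefers/negP.
  case=> [cD|E]; last by rewrite inE -E eqxx in Dj.
  have [_ _] := DA_stable q P s; apply; exists j, c; split=> //.
  by exists i0; rewrite ?higher // inE -/(D P) Di.
have [d Djd dN] := school j worse_j.
have cNj : P j (Some c) None by case: (IRF j); rewrite FjE.
have /card_le1_eqP/(_ c d) := small _ worse_j; rewrite !inE => /(_ cNj dN) E.
by rewrite FjE Djd E strict_irr in worse_j.
Qed.

Lemma not_better (P : pref_profile I C) i : ~ P i (F P i) (D P i).
Proof.
move=> better.
have [IRD _ _] := DA_stable q P s.
have FN : P i (F P i) None.
  by case: (IRD i) => [|<-] //; apply: strict_trans.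
pose A x := (x == F P i) || P i x (F P i).
have AN : ~~ A None.
  apply/norP; split; first by apply: contraL FN => /eqP<-; rewrite strict_irr.
  by apply/negP=> /(strict_asym FN).
pose p' := restrict A (P i); pose P' := deviate P i p'.
have A_up x y : A y -> p' x y -> A x by move=> Ay /(restrict_in (A := A) Ay)[].
have FP'A : A (F P' i).
  have AF : A (F P i) by rewrite /A eqxx.
  (* At [P'], the true list [P i] counts as a misreport that yields [F P i]. *)
  have back : weakly_prefers p' (F P' i) (F P i).
    by have := SP i w tau P' (P i); rewrite /P' deviate_back deviate_same.
  by case: back => [/(A_up _ _ AF)|->].
have [IR' NW' _] := DA_stable q P' s.
have DA' : A (D P' i).
  have: D P' i != None.
    apply: (dominating_matched IR' NW') => [j|]; first by apply/not_prefers/not_worse.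
    by apply: contraNneq AN => <-.
  by case: (IR' i) => [|->] //; rewrite {1}/P' deviate_same restrict_None.
(* Whatever [P i] ranks above [D P' i] lies in [A], where [p'] and [P i] agree. *)
have st : stable P s (D P').
  apply: stable_transfer (DA_stable q P' s) => [j x|j].
    have [->|ji] := eqVneq j i; last by rewrite /P' deviate_other.
    rewrite {2}/P' deviate_same -/(D P') => Px; rewrite restrict_agree //.
    case/orP: DA' => [/eqP E|PD]; rewrite /A; first by rewrite -E Px orbT.
    by rewrite (strict_trans Px PD) orbT.
  have [->|ji] := eqVneq j i; last by have := IR' j; rewrite /P' deviate_other.
  left; case/orP: DA' => [/eqP->|PD] //; exact: strict_trans PD FN.
have := DA_optimal st i; rewrite -/(D P) => DD'.
apply: (prefers_not _ better); apply: prefers_trans DD' _.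
by case/orP: DA' => [/eqP->|]; [right | left].
Qed.

End Mechanism.

Theorem corollary1 (I C : finType) (q : C -> nat) (phi : mechanism I q) :
  strategy_proof phi -> weak_rank_monotone phi -> strong_RD_stable phi ->
  forall (P : pref_profile I C) (w : weak_profile I C) (tau : strict_profile I C),
    outcome phi P w tau = DA q P (refine_profile w tau).
Proof.
move=> SP WRM RDS P w tau; apply/val_inj/ffunP=> i.
have [worse|->//] := not_prefers (not_better SP WRM RDS (w := w) (tau := tau) (P := P) (i := i)).
by case: (not_worse SP WRM RDS worse).
Qed.
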